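(* Let $K$ be a field, $S=K[x_0,\ldots,x_n]$ with $x_0<x_1<\cdots<x_n$, and let $J\subseteq S$ be a strongly stable monomial ideal. There is a one to one correspondence between the homogeneous ideals $I\subseteq S$ such that $\mathcal N(J)$ is a $K$-basis of $S/I$ and the points of the affine scheme in $K^N$ defined by the ideal $\mathfrak R\subseteq K[C]$ (a point $c\in K^N$ corresponding to the ideal generated by the polynomials of $\mathcal G$ specialized at $C=c$). Moreover, $\mathfrak R'=\mathfrak R$.
   Context: A term is a monomial $x^\alpha=x_0^{\alpha_0}\cdots x_n^{\alpha_n}$; for a term $x^\beta\neq 1$, $\min(x^\beta)$ is the smallest variable dividing it. A monomial ideal $J$ is strongly stable if for every term $x^\alpha\in J$ and all $0\le i<j\le n$ with $\alpha_i>0$, the term $x_j x^\alpha/x_i$ belongs to $J$. $B_J$ is the minimal set of monomial generators of $J$, $\mathcal N(J)$ is the set of terms not in $J$, and $\mathcal N(J)_d$ the set of those of degree $d$. For every $x^\alpha\in B_J$ let $F_\alpha:=x^\alpha-\sum_{x^\gamma\in\mathcal N(J)_{|\alpha|}}C_{\alpha\gamma}x^\gamma$, where the $C_{\alpha\gamma}$ are new variables; $C$ is the set of all these variables, $N=|C|$, and $\mathcal G=\{F_\alpha : x^\alpha\in B_J\}$, with head terms $Ht(F_\alpha)=x^\alpha$. The sets $\mathcal V_m$: to every term $x^\beta\in J$ associate a polynomial $g_\beta$ with head term $x^\beta$, by induction on degree: if $x^\beta\in B_J$, $g_\beta:=F_\beta$; otherwise, with $x_i=\min(x^\beta)$ and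 $x^\epsilon=x^\beta/x_i$ (which lies in $J$), $g_\beta:=x_ig_\epsilon$. Then $\mathcal V_m:=\{g_\beta : x^\beta\in J\text{ a term of degree }m\}$. For $h\in K[C][x_0,\ldots,x_n]$ homogeneous of degree $m$ in the $x_i$, its $\mathcal V_m$-reduction is the polynomial with all its $x$-terms in $\mathcal N(J)$ obtained from $h$ by finitely many steps each replacing the current polynomial $h'$ by $h'-a\,g_\beta$, where $x^\beta\in J$ is a term occurring in $h'$ with coefficient $0\neq a\in K[C]$ (this terminates with a unique result). The $S$-polynomial is $S(F_\alpha,F_{\alpha'})=x^\delta F_\alpha-x^{\delta'}F_{\alpha'}$, where $x^{\delta+\alpha}=x^{\delta'+\alpha'}=\mathrm{lcm}(x^\alpha,x^{\alpha'})$. $\mathfrak R\subseteq K[C]$ is the ideal generated by all the coefficients (in $K[C]$, with respect to the $x$-terms) of the $\mathcal V_m$-reductions of all $S$-polynomials $S(F_\alpha,F_{\alpha'})$, $F_\alpha,F_{\alpha'}\in\mathcal G$. $\mathfrak R'$ is the ideal generated in the same way but considering only those $S$-polynomials $x^\delta F_\alpha-x^{\delta'}F_{\alpha'}$ such that $x^\delta F_\alpha\in\mathcal V_m$, where $m=|\delta+\alpha|$. *)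

(* Defs.v *)
From HB Require Import structures.
From mathcomp Require Import all_boot all_order all_algebra.
From mathcomp Require Import boolp classical_sets functions.
From mathcomp Require Import mpoly.

Set Implicit Arguments.
Unset Strict Implicit.
Unset Printing Implicit Defensive.

Import GRing.Theory.
Local Open Scope ring_scope.
Local Open Scope classical_set_scope.

(* MathComp's idealr structures only cover proper ideals with a boolean
   membership test, hence these set-based versions. *)
Definition is_ideal (A : comNzRingType) (I : set A) : Prop :=
  [/\ I 0, (forall p q, I p -> I q -> I (p + q))
      & (forall a p, I p -> I (a * p))].

Definition ideal_gen (A : comNzRingType) (X : set A) : set A :=
  smallest (@is_ideal A) X.

Section MonomialIdeals.
Context {K : fieldType} {n : nat}.
Implicit Types (I J : set {mpoly K[n.+1]}) (M : set 'X_{1..n.+1}).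

Definition homogeneous_ideal I : Prop :=
  is_ideal I /\ forall p d, I p -> I (pihomog mdeg d p).

Definition term_ideal M : set {mpoly K[n.+1]} :=
  ideal_gen [set 'X_[K, a] | a in M].

Definition monomial_ideal J : Prop := exists M, J = term_ideal M.

Definition strongly_stable J : Prop :=
  forall (a : 'X_{1..n.+1}) (i j : 'I_n.+1), J 'X_[a] -> (i < j)%N ->
    (0 < a i)%N -> J 'X_[a - U_(i) + U_(j)].

Definition min_generating J M : Prop :=
  J = term_ideal M /\
  forall M', M' `<=` M -> J = term_ideal M' -> M' = M.

(* The minimal generating set is unique and, by Dickson's lemma, finite (see
   min_gensP below), so this is a listing of it, in an arbitrary order. *)
Definition min_gens J : seq 'X_{1..n.+1} :=
  xget [::] [set s | uniq s /\ min_generating J [set` s]].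

Definition normal_term J : set 'X_{1..n.+1} := [set c | ~ J 'X_[c]].

Definition normal_terms_deg J (d : nat) : seq 'X_{1..n.+1} :=
  [seq val c | c <- enum {: 'X_{1..n.+1 < d.+1}} &
               (mdeg (val c) == d) && `[< normal_term J (val c) >]].

(* The classes of the terms in M form a K-basis of S/I: a finite K-linear
   combination of terms in M is a polynomial with support in M. *)
Definition quotient_basis I M : Prop :=
  (forall p, (forall c, c \in msupp p -> M c) -> I p -> p = 0) /\
  (forall p, exists2 q, (forall c, c \in msupp q -> M c) & I (p - q)).

Definition min_var (b : 'X_{1..n.+1}) : 'I_n.+1 :=
  [arg min_(i < ord0 | (0 < b i)%N) (i : nat)].

End MonomialIdeals.

Section Scheme.
Context {K : fieldType} {n : nat} (J : set {mpoly K[n.+1]}).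
Local Notation mon := 'X_{1..n.+1}.

(* The variable C_{a c} is identified with the position of (a, c) in this list;
   K[C] is then {mpoly K[nparams]}. *)
Definition params : seq (mon * mon) :=
  [seq (a, c) | a <- min_gens J, c <- normal_terms_deg J (mdeg a)].

Definition nparams : nat := size params.

Local Notation KC := {mpoly K[nparams]}.
Local Notation KCx := {mpoly {mpoly K[nparams]}[n.+1]}.

Definition param (k : 'I_nparams) : mon * mon := tnth (in_tuple params) k.

Definition Fpoly (a : mon) : KCx :=
  'X_[a] - \sum_(k < nparams | (param k).1 == a) ('X_k : KC) *: 'X_[(param k).2].

Fixpoint gpoly_rec (d : nat) (b : mon) : KCx :=
  if b \in min_gens J then Fpoly b else
  if d is d'.+1 then 'X_(min_var b) * gpoly_rec d' (b - U_(min_var b))%MM else 0.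

(* The fuel mdeg b suffices for every term b of J. *)
Definition gpoly (b : mon) : KCx := gpoly_rec (mdeg b) b.

Definition Vset (m : nat) : set KCx :=
  [set gpoly b | b in [set b | J 'X_[b] /\ mdeg b = m]].

Inductive V_reduction (m : nat) : KCx -> KCx -> Prop :=
| V_reduced h : (forall c, c \in msupp h -> normal_term J c) ->
    V_reduction m h h
| V_step h b r : J 'X_[b] -> mdeg b = m -> h@_b != 0 ->
    V_reduction m (h - h@_b *: gpoly b) r -> V_reduction m h r.

Definition spoly (a a' : mon) : KCx :=
  'X_[mlcm a a' - a] * Fpoly a - 'X_[mlcm a a' - a'] * Fpoly a'.

Definition spoly_reduction_coeff (a a' : mon) : set KC :=
  [set u | exists r c, V_reduction (mdeg (mlcm a a')) (spoly a a') r /\ u = r@_c].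

Definition frakR : set KC :=
  ideal_gen [set u | exists a a', [/\ a \in min_gens J, a' \in min_gens J
                                    & spoly_reduction_coeff a a' u]].

Definition frakR' : set KC :=
  ideal_gen [set u | exists a a', [/\ a \in min_gens J, a' \in min_gens J,
                                      Vset (mdeg (mlcm a a')) ('X_[mlcm a a' - a] * Fpoly a)
                                    & spoly_reduction_coeff a a' u]].

Definition zero_locus (R : set KC) : set {ffun 'I_nparams -> K} :=
  [set c | forall u, R u -> u.@[c] = 0].

Definition specialized_ideal (c : {ffun 'I_nparams -> K}) : set {mpoly K[n.+1]} :=
  ideal_gen [set map_mpoly (meval c) (Fpoly a) | a in [set` min_gens J]].

End Scheme.

Arguments frakR {K n} J _.
Arguments frakR' {K n} J _.
Arguments specialized_ideal {K n} J c _.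

Section WellDefined.
Context {K : fieldType} {n : nat}.
Implicit Types (J : set {mpoly K[n.+1]}) (M : set 'X_{1..n.+1}).

Lemma ideal_gen_is_ideal (A : comNzRingType) (X : set A) :
  is_ideal (ideal_gen X).
Proof.
split=> [I [[]//]|p q Ip Iq I IX|a p Ip I IX].
  by have [[_ + _] _] := IX; apply; [exact: Ip | exact: Iq].
by have [[_ _ +] _] := IX; apply; exact: Ip.
Qed.

Lemma term_idealP M (b : 'X_{1..n.+1}) :
  term_ideal (K := K) M 'X_[b] <-> exists2 a, M a & (a <= b)%MM.
Proof.
split; last first.
  move=> [a Ma ab]; have [_ _ idM] := ideal_gen_is_ideal [set 'X_[K, a] | a in M].
  by rewrite -(submK ab) mpolyXD; apply: idM => I [_]; apply; exists a.
pose I := [set p : {mpoly K[n.+1]} |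
           forall b, b \in msupp p -> exists2 a, M a & (a <= b)%MM].
suff MI : term_ideal M `<=` I by move=> /MI; apply; rewrite msuppX inE.
apply: smallest_sub; last first.
  move=> _ [a Ma <-] c; rewrite msuppX inE => /eqP ->.
  by exists a => //; exact: lepm_refl.
split=> [c|p q Ip Iq c|p q Iq c].
- by rewrite msupp0.
- by move=> /msuppD_le; rewrite mem_cat => /orP [/Ip|/Iq].
- move=> /msuppM_le /allpairsP [[c1 c2] /= [_ /Iq [a Ma ac] ->]].
  by exists a => //; apply: lepm_trans ac (lem_addl _ _).
Qed.

Lemma dickson M : exists s : seq 'X_{1..n.+1},
  (forall a, a \in s -> M a) /\
  (forall b, M b -> exists2 a, a \in s & (a <= b)%MM).
Proof.
suff dickson_in k (A : {set 'I_n.+1}) : #|A| = k ->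
    forall M, (forall a b, M a -> M b -> forall i, i \notin A -> a i = b i) ->
    exists s : seq 'X_{1..n.+1}, (forall a, a \in s -> M a) /\
      (forall b, M b -> exists2 a, a \in s & (a <= b)%MM).
  by apply: (dickson_in _ (finset.setTfor _) erefl M) => a b _ _ i; rewrite inE.
elim: k A => [|k IHk] A cardA {}M MA;
    (have [[a Ma]|/forallNP M0] := pselect (exists a, M a);
    last by exists [::]; split=> // b /M0).
  exists [:: a]; split=> [b|b Mb]; first by rewrite inE => /eqP ->.
  exists a; first by rewrite inE.
  apply/mnm_lepP => i; rewrite (MA a b Ma Mb) //.
  by move/eqP: cardA; rewrite cards_eq0 => /eqP ->; rewrite inE.
have slice i v : exists s : seq 'X_{1..n.+1},
    (forall c, c \in s -> M c) /\
    ((v < a i)%N -> forall b, M b -> b i = v ->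
       exists2 c, c \in s & (c <= b)%MM).
  have [iA|iA] := boolP (i \in A); last first.
    exists [::]; split=> // via b Mb biv.
    by move: via; rewrite -biv (MA a b Ma Mb) // ltnn.
  have cardAi : #|(A :\ i)%SET| = k.
    by apply/eqP; rewrite -eqSS -cardA (cardsD1 i A) iA.
  have [|s [sM sP]] := IHk _ cardAi [set b | M b /\ b i = v].
    move=> b c [Mb bi] [Mc ci] j; rewrite in_setD1 negb_and negbK.
    by case/orP => [/eqP ->|jA]; [rewrite bi ci | apply: MA].
  by exists s; split=> [c /sM []//|_ b Mb biv]; apply: sP.
have [s sP] := choice (fun p : 'I_n.+1 * nat => slice p.1 p.2).
exists (a :: flatten [seq s (i, v) | i <- enum 'I_n.+1, v <- iota 0 (a i)]).
split=> [c|b Mb].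
  rewrite inE => /orP [/eqP -> //|/flattenP [_ /allpairsPdep [i [v [_ _ ->]]]]].
  exact: (sP (i, v)).1.
have [ab|/mnm_lepP nab] := boolP (a <= b)%MM.
  by exists a => //; rewrite inE eqxx.
have [i bia] : exists i, (b i < a i)%N.
  by apply: contrapT => /forallNP nb; apply: nab => i; rewrite leqNgt; apply/negP.
have [c cs cb] := (sP (i, b i)).2 bia b Mb erefl.
exists c => //; rewrite inE; apply/orP; right; apply/flattenP.
exists (s (i, b i)) => //; apply/allpairsPdep; exists i, (b i).
by split=> //; rewrite ?mem_enum// mem_iota.
Qed.

Lemma term_ideal_sub M M' :
  (forall a, M a -> exists2 b, M' b & (b <= a)%MM) ->
  term_ideal (K := K) M `<=` term_ideal M'.
Proof.
move=> MM'; apply: smallest_sub; first exact: ideal_gen_is_ideal.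
by move=> _ [a /MM' Ma <-]; apply/term_idealP.
Qed.

Lemma min_gensP J : monomial_ideal J ->
  [/\ uniq (min_gens J), min_generating J [set` min_gens J]
    & forall a, a \in min_gens J <->
        J 'X_[a] /\ forall b, J 'X_[b] -> (b <= a)%MM -> b = a].
Proof.
move=> [M JM].
have mem_min M' a : min_generating J M' ->
    M' a <-> J 'X_[a] /\ forall b, J 'X_[b] -> (b <= a)%MM -> b = a.
  move=> [JM' minM']; split=> [M'a|[]].
    split; first by rewrite JM'; apply/term_idealP; exists a => //; exact: lepm_refl.
    move=> b; rewrite JM' => /term_idealP [c M'c cb] ba.
    have [ca|/eqP ca] := eqVneq c a.
      by apply/mnmP => i; apply/eqP; rewrite eqn_leq; move/mnm_lepP: ba => ->;
         rewrite -ca; move/mnm_lepP: cb => ->.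
    suff eqM' : M' `\ a = M' by move: M'a; rewrite -eqM' => -[_]; case.
    apply: minM'; first by move=> ? [].
    rewrite {1}JM'; apply/seteqP; split; apply: term_ideal_sub => d.
      have [->|/eqP da] := eqVneq d a => M'd.
        by exists c => //; apply: lepm_trans cb ba.
      by exists d => //; exact: lepm_refl.
    by move=> [M'd _]; exists d => //; exact: lepm_refl.
  by rewrite {1}JM' => /term_idealP [c M'c ca] /(_ c) <- //; rewrite JM';
     apply/term_idealP; exists c => //; exact: lepm_refl.
suff [uJ minJ] : [set s | uniq s /\ min_generating J [set` s]] (min_gens J).
  by split=> // a; exact: (mem_min _ a minJ).
have [s [sM sP]] := dickson M.
pose t := undup [seq a <- s | all (fun b => (b <= a)%MM ==> (b == a)) s].
apply: (@xgetI _ _ _ t) => /=; split; first exact: undup_uniq.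
have tM : [set` t] `<=` M.
  by move=> a /=; rewrite mem_undup mem_filter => /andP [_ /sM].
have tP b : M b -> exists2 a, a \in t & (a <= b)%MM.
  move=> /sP [a0 a0s a0b].
  have ex_d : exists d, has (fun a => (a <= b)%MM && (mdeg a == d)) s.
    by exists (mdeg a0); apply/hasP; exists a0; rewrite ?a0b ?eqxx.
  case: (ex_minnP ex_d) => d /hasP [a as_ /andP [ab /eqP <-]] amin.
  exists a => //; rewrite mem_undup mem_filter as_ andbT.
  apply/allP => c cs; apply/implyP => ca; have cb := lepm_trans ca ab.
  have /amin : has (fun a => (a <= b)%MM && (mdeg a == mdeg c)) s.
    by apply/hasP; exists c; rewrite ?cb ?eqxx.
  rewrite -(submK ca) mdegD -{2}[mdeg c]add0n leq_add2r leqn0 mdeg_eq0.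
  by move=> /eqP ->; rewrite add0m.
have JT T : T `<=` M -> (forall b, M b -> exists2 a, T a & (a <= b)%MM) ->
    J = term_ideal T.
  move=> TM MT; rewrite JM; apply/seteqP; split; apply: term_ideal_sub => // a Ta.
  by exists a; [exact: TM | exact: lepm_refl].
split; first exact: JT.
move=> M' M't JM'; apply/seteqP; split=> // a ta.
have : J 'X_[a] by rewrite JM; apply/term_idealP; exists a; [exact: tM | exact: lepm_refl].
rewrite JM' => /term_idealP [c M'c ca].
have cs : c \in s by have /= := M't _ M'c; rewrite mem_undup mem_filter => /andP [].
by move: ta; rewrite /= mem_undup mem_filter => /andP [/allP /(_ c cs)]; rewrite ca => /eqP <-.
Qed.

Lemma min_varP (b : 'X_{1..n.+1}) : b <> 0%MM ->
  (0 < b (min_var b))%N /\ forall i, (0 < b i)%N -> (min_var b <= i)%N.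
Proof.
move=> b0; have [i bi] : exists i, (0 < b i)%N.
  apply: contrapT => /forallNP bi0; apply: b0; apply/mnmP => i.
  by rewrite mnm0E; apply/eqP; rewrite -leqn0 leqNgt; apply/negP.
rewrite /min_var /fintype.arg_min /fintype.extremum; case: pickP => /= [j /andP [bj /forallP jP]|P0].
  by split=> // k; apply/implyP.
case: (@arg_minnP _ i (fun i => 0 < b i)%N (fun i => i : nat) bi) => j bj jP.
by have := P0 j; rewrite /= bj /=; case/forallP => k; apply/implyP/jP.
Qed.

Lemma gpolyE J (b : 'X_{1..n.+1}) : b <> 0%MM -> b \notin min_gens J ->
  gpoly J b = 'X_(min_var b) * gpoly J (b - U_(min_var b))%MM.
Proof.
move=> b0 /negPf bJ; have [bi _] := min_varP b0.
have Ub : (U_(min_var b) <= b)%MM by rewrite lep1mP -lt0n.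
by rewrite {1}/gpoly -{1}(submK Ub) mdegD mdeg1 addn1 /= bJ.
Qed.

End WellDefined.

(* Main.v *)
(* Every term of J factors uniquely as x^e x^a with x^a in B_J and no variable of
   x^e larger than one of x^a; the polynomials g of V_m are exactly the x^e F_a
   for these factorizations.  If x^e x^c lies in J with x^c normal, then its own
   factorization x^e' x^a' has x^e' lexicographically smaller than x^e (largest
   variable first).  Hence reduction terminates, and a polynomial with normal
   support in the K[C]-span of the g's plus a K[C][x] (a an ideal of K[C]) has all
   its coefficients in a.

   If the S-polynomials defining R' reduce to 0 modulo a, then every x^e F_a lies in
   the span of the g's modulo a: when the factorization is not the good one,
   subtract x^e' F_a' for the good one x^e' x^a'; the difference is a multiple of an
   S-polynomial of R', reducing through smaller x^e only.  With a = R' this gives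
   R' = R.  With a = R and C specialized at a zero c of R, the span of the
   specialized g's is the ideal generated by the specialized F's, which is thus a
   complement of the span of N(J).  Conversely, if N(J) is a basis of S/I, the normal
   forms modulo I of the generators of J are the tails of a unique specialization
   of the F's. *)
Require Import Defs.
From mathcomp Require Import all_boot all_order all_algebra.
From mathcomp Require Import boolp classical_sets functions.
From mathcomp Require Import mpoly zify.

Local Open Scope ring_scope.
Local Open Scope classical_set_scope.
Set Implicit Arguments.
Unset Strict Implicit.
Import GRing.Theory.

(** * Elementary facts about ideals *)

Lemma ideal_gen_sub (A : comNzRingType) (X : set A) : X `<=` ideal_gen X.
Proof. exact: sub_gen_smallest. Qed.

Lemma ideal_gen_min (A : comNzRingType) (X I : set A) :
  is_ideal I -> X `<=` I -> ideal_gen X `<=` I.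
Proof. exact: smallest_sub. Qed.

Lemma is_idealN (A : comNzRingType) (I : set A) p : is_ideal I -> I p -> I (- p).
Proof. by case=> _ _ IM Ip; rewrite -mulN1r; apply: IM. Qed.

Lemma is_idealB (A : comNzRingType) (I : set A) p q :
  is_ideal I -> I p -> I q -> I (p - q).
Proof. by move=> II Ip Iq; have [_ ID _] := II; apply: ID => //; apply: is_idealN. Qed.

Lemma is_ideal_sum (A : comNzRingType) (I : set A) (T : eqType) (r : seq T)
    (F : T -> A) :
  is_ideal I -> (forall i, i \in r -> I (F i)) -> I (\sum_(i <- r) F i).
Proof.
move=> [I0 ID _] IF; rewrite big_seq.
by elim/big_ind : _ => // i ir; exact: IF.
Qed.

(** * Factorizations of the terms of a strongly stable ideal *)

Section Weight.
Context {n : nat}.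
Implicit Types e a g : 'X_{1..n}.

(* Orders the terms of degree below M lexicographically, with the last variable most
   significant. *)
Definition wt (M : nat) e : nat := \sum_(i < n) e i * M ^ i.

Lemma wtD M e e' : wt M (e + e')%MM = (wt M e + wt M e')%N.
Proof. by rewrite -big_split; apply: eq_bigr => i _; rewrite mnmDE mulnDl. Qed.

(** In base [M], the digits of [e'] below position [j] amount to less than [M ^ j], because their
    sum is at most [mdeg e' < M]; one more unit at position [j] outweighs them. *)
Lemma wt_lt M e e' (j : 'I_n) : (mdeg e' < M)%N -> (e' j < e j)%N ->
  (forall i : 'I_n, (j < i)%N -> e' i = e i) -> (wt M e' < wt M e)%N.
Proof.
move=> e'M ej eqe; have M0 : (0 < M)%N by apply: leq_ltn_trans e'M.
have split_wt f : wt M f = (\sum_(i < n | i < j) f i * M ^ i + f j * M ^ j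
    + \sum_(i < n | j < i) f i * M ^ i)%N.
  rewrite /wt (bigID (fun i : 'I_n => (i < j)%N)) /= -addnA; congr addn.
  rewrite (bigD1 j) ?ltnn//=; congr addn; apply: eq_bigl => i.
  by rewrite -leqNgt ltn_neqAle andbC eq_sym.
rewrite !split_wt.
have -> : (\sum_(i < n | j < i) e i * M ^ i = \sum_(i < n | j < i) e' i * M ^ i)%N.
  by apply: eq_bigr => i /eqe ->.
rewrite ltn_add2r.
suff low : (\sum_(i < n | i < j) e' i * M ^ i < M ^ j)%N.
  apply: (@leq_trans (M ^ j + e' j * M ^ j)); first by rewrite ltn_add2r.
  by rewrite -mulSn; apply: leq_trans (leq_addl _ _); rewrite leq_mul2r ej orbT.
rewrite -(ltn_pmul2l M0) big_distrr /=.
apply: (@leq_ltn_trans (mdeg e' * M ^ j)%N); last first.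
  by rewrite ltn_pmul2r// expn_gt0 M0.
rewrite mdegE big_distrl /= [leqRHS](bigID (fun i : 'I_n => (i < j)%N)) /=.
apply: leq_trans (leq_addr _ _); apply: leq_sum => i ij.
by rewrite mulnCA -expnS leq_mul2l leq_pexp2l ?orbT.
Qed.

(** If [e] and [e'] differ, the weights give [e j < e' j] at the largest index [j] where they do.
    Above [j] the exponents of [g] and [a'] agree, at [j] that of [g] is larger, and below [j]
    separation forces [a'] to vanish. *)
Lemma factor_dvd M e g e' a' : (mdeg e' < M)%N ->
  (forall i j, (0 < e' i)%N -> (0 < a' j)%N -> (i <= j)%N) ->
  (e + g = e' + a')%MM -> (wt M e <= wt M e')%N -> (a' <= g)%MM.
Proof.
move=> e'M sep eq_ea le_wt.
have eq_i i : (e i + g i = e' i + a' i)%N by rewrite -!mnmDE eq_ea.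
have [ee'|/eqP nee'] := pselect (e = e').
  by apply/mnm_lepP => i; have := eq_i i; rewrite ee'; lia.
have [i0 ne_i0] : exists i, e i != e' i.
  apply: contrapT => /forallNP E; apply/(elimN eqP nee')/mnmP => i.
  by apply/eqP; apply: contrapT => /negP; exact: E.
pose P (i : 'I_n) := e i != e' i.
have [j ne_j j_max] := @arg_maxnP _ i0 P (fun i => i : nat) ne_i0.
have eq_above (i : 'I_n) : (j < i)%N -> e i = e' i.
  by move=> ji; apply/eqP; apply: contraTT ji => /j_max; rewrite -leqNgt.
have ej : (e j < e' j)%N.
  rewrite ltn_neqAle [_ != _]ne_j leqNgt; apply/negP => e'j.
  have := wt_lt e'M e'j (fun i ji => esym (eq_above i ji)).
  by rewrite ltnNge le_wt.
apply/mnm_lepP => i; have := eq_i i; case: (ltngtP i j) => [ij|ji|/val_inj ->].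
- suff -> : a' i = 0%N by [].
  apply/eqP; rewrite -leqn0 leqNgt; apply/negP => a'i.
  have ej0 : (0 < e' j)%N by lia.
  by have := sep j i ej0 a'i; rewrite leqNgt ij.
- by rewrite eq_above //; lia.
- by lia.
Qed.

End Weight.

(** * Spans over the coefficient ring modulo an ideal *)

Section Span.
Context {A : comNzRingType} {n : nat}.
Local Notation Ax := {mpoly A[n]}.
Implicit Types (I : set A) (G : set Ax) (p q : Ax).

(** The elements of [G] are multiplied by scalars of [A] only; that the span of the g's absorbs
    multiplication by terms has to be proved. *)
Inductive span_mod I G : Ax -> Prop :=
| span_mod_coef q : (forall c, I q@_c) -> span_mod I G q
| span_mod_comb u g p : G g -> span_mod I G p -> span_mod I G (u *: g + p).

Lemma span_mod_gen I G g : I 0 -> G g -> span_mod I G g.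
Proof.
move=> I0 Gg; rewrite -[g]addr0 -[g]scale1r; apply: span_mod_comb => //.
by apply: span_mod_coef => c; rewrite mcoeff0.
Qed.

Lemma span_modD I G p q : is_ideal I ->
  span_mod I G p -> span_mod I G q -> span_mod I G (p + q).
Proof.
move=> II; have [_ ID _] := II; elim=> [p' p'I|u g p' Gg _ IH] Gq.
  elim: Gq => [q' q'I|u g q' Gg _ IH]; last by rewrite addrCA; apply: span_mod_comb.
  by apply: span_mod_coef => c; rewrite mcoeffD; apply: ID.
by rewrite -addrA; apply: span_mod_comb => //; apply: IH.
Qed.

Lemma span_modZ I G u p : is_ideal I -> span_mod I G p -> span_mod I G (u *: p).
Proof.
move=> [_ _ IM]; elim=> [q qI|v g q Gg _ IH].
  by apply: span_mod_coef => c; rewrite mcoeffZ; apply: IM.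
by rewrite scalerDr scalerA; apply: span_mod_comb.
Qed.

Lemma span_modB I G p q : is_ideal I ->
  span_mod I G p -> span_mod I G q -> span_mod I G (p - q).
Proof.
move=> II Gp Gq; rewrite -scaleN1r.
by apply: span_modD => //; apply: span_modZ.
Qed.

Lemma span_mod_mul I I' G H q p : is_ideal I' -> I `<=` I' ->
  (forall g, G g -> span_mod I' H (q * g)) ->
  span_mod I G p -> span_mod I' H (q * p).
Proof.
move=> I'I II' GH; elim=> [r rI|v g r Gg _ IH].
  apply: span_mod_coef => c; rewrite mcoeffM; have [I0 ID IM] := I'I.
  by elim/big_ind: _ => // k _; apply/IM/II'.
by rewrite mulrDr -scalerAr; apply: span_modD => //; apply: span_modZ => //; apply: GH.
Qed.

Lemma span_mod_sub I I' G H : is_ideal I' -> I `<=` I' ->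
  (forall g, G g -> span_mod I' H g) -> span_mod I G `<=` span_mod I' H.
Proof.
move=> I'I II' GH p Gp; rewrite -[p]mul1r; apply: (span_mod_mul _ II' _ Gp) => //.
by move=> g Gg; rewrite mul1r; apply: GH.
Qed.

End Span.

Lemma is_ideal0 (A : comNzRingType) : is_ideal [set (0 : A)].
Proof.
by split=> // [p q /= -> ->|a p /= ->]; rewrite ?addr0 ?mulr0.
Qed.

Lemma mcoeffXM (A : comNzRingType) n (e c : 'X_{1..n}) (p : {mpoly A[n]}) :
  ('X_[e] * p)@_(e + c) = p@_c.
Proof. by rewrite mulrC mcoeffMX. Qed.

Lemma msuppXM (A : comNzRingType) n (e c : 'X_{1..n}) (p : {mpoly A[n]}) :
  c \in msupp ('X_[e] * p) -> exists2 d, d \in msupp p & c = (e + d)%MM.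
Proof. by rewrite mulrC (perm_mem (msuppMX _ _)) => /mapP. Qed.

(** * Canonical factorizations and the polynomials g *)

Section Canon.
Context {K : fieldType} {n : nat} (J : set {mpoly K[n.+1]}).
Hypotheses (J_monomial : monomial_ideal J) (J_stable : strongly_stable J).
Local Notation mon := 'X_{1..n.+1}.
Local Notation KC := {mpoly K[nparams J]}.
Local Notation KCx := {mpoly {mpoly K[nparams J]}[n.+1]}.
Implicit Types (a b c e : mon).

(** Up to reversing the order of the variables, this is the decomposition of Eliahou and Kervaire
    for stable ideals. *)
Definition canon e a : Prop :=
  a \in min_gens J /\ forall i j, (0 < e i)%N -> (0 < a j)%N -> (i <= j)%N.

Lemma min_gens_in a : a \in min_gens J -> J 'X_[a].
Proof. by have [_ _ E] := min_gensP J_monomial; move=> /E[]. Qed.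

Lemma min_gens_min a b : a \in min_gens J -> J 'X_[b] -> (b <= a)%MM -> b = a.
Proof. by have [_ _ E] := min_gensP J_monomial; move=> /E[_]; exact. Qed.

Lemma in_monomial_ideal b : J 'X_[b] <-> exists2 a, a \in min_gens J & (a <= b)%MM.
Proof.
have [_ [JE _] _] := min_gensP J_monomial.
have JbE := congr1 (fun I : set _ => I 'X_[b]) JE; rewrite /= in JbE.
by rewrite JbE; exact: term_idealP.
Qed.

Lemma J_up a b : J 'X_[a] -> (a <= b)%MM -> J 'X_[b].
Proof.
by move=> /in_monomial_ideal[g gJ ga] ab; apply/in_monomial_ideal; exists g => //;
   exact: lepm_trans ab.
Qed.

Lemma canon_in e a : canon e a -> J 'X_[e + a].
Proof. by move=> [/min_gens_in aJ _]; apply: J_up aJ (lem_addl _ _). Qed.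

Lemma canon_sub d e a : canon (d + e)%MM a -> canon e a.
Proof. by move=> [aJ sep]; split => // i j ei; apply: sep; rewrite mnmDE; lia. Qed.

(** Strong stability enters here. Let a generator [a] properly divide [b], and let [i] be the
    smallest variable of [b]. If [a i < b i], then [a] still divides the quotient; otherwise some
    [j > i] has [a j < b j], and exchanging [i] for [j] in [a] gives a term of [J] that divides
    it. *)
Lemma divide_min_var b : J 'X_[b] -> b \notin min_gens J ->
  b <> 0%MM /\ J 'X_[b - U_(min_var b)].
Proof.
move=> /in_monomial_ideal[a aJ ab] bJ.
have neab : a <> b by move=> E; rewrite -E aJ in bJ.
have b0 : b <> 0%MM.
  move=> b0; apply: neab; apply/mnmP => i; have := mnm_lepP ab i.
  by rewrite b0 mnm0E; lia.
split => //; have [bi bmin] := min_varP b0; set i := min_var b in bi bmin *.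
have [lt_ab|le_ba] := ltnP (a i) (b i).
  apply: (J_up (min_gens_in aJ)); apply/mnm_lepP => k.
  have := mnm_lepP ab k; rewrite mnmBE mnm1E; case: eqP => [<-|_] /=; lia.
have eq_i : a i = b i by apply/eqP; rewrite eqn_leq le_ba (mnm_lepP ab).
have [j ltj] : exists j, (a j < b j)%N.
  apply: contrapT => /forallNP ge; apply: neab; apply/mnmP => k.
  by have := mnm_lepP ab k; have /negP := ge k; lia.
have neij : i != j by apply/eqP => E; move: ltj; rewrite -E eq_i ltnn.
have ltij : (i < j)%N.
  by rewrite ltn_neqAle neij; apply: bmin; exact: leq_ltn_trans ltj.
have := J_stable (min_gens_in aJ) ltij; rewrite eq_i => /(_ bi) /J_up; apply.
apply/mnm_lepP => k; have := mnm_lepP ab k; rewrite mnmDE !mnmBE !mnm1E.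
case: (eqVneq i k) => [ik|_]; case: (eqVneq j k) => [jk|_] /=; subst; move: neij;
  rewrite ?eqxx; try lia.
Qed.

Lemma canon_exists b : J 'X_[b] -> exists e a, canon e a /\ b = (e + a)%MM.
Proof.
have [m] := ubnP (mdeg b); elim: m b => // m IH b bm bJ.
have [bB|bB] := boolP (b \in min_gens J).
  by exists 0%MM, b; split; [split => // i j; rewrite mnm0E | rewrite add0m].
have [b0 bJ'] := divide_min_var bJ bB; have [bi bmin] := min_varP b0.
have Ub : (U_(min_var b) <= b)%MM by rewrite lep1mP -lt0n.
have [|e [a [[aB sep] E]]] := IH _ _ bJ'.
  by move: bm; rewrite -{1}(submK Ub) mdegD mdeg1; lia.
exists (e + U_(min_var b))%MM, a; split; last first.
  by rewrite -addmA [(U_(_) + _)%MM]addmC addmA -E submK.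
split => // i j; rewrite mnmDE mnm1E; case: eqVneq => [<- _ aj|_].
  by apply: bmin; rewrite -(submK Ub) mnmDE E mnmDE; lia.
by rewrite addn0; exact: sep.
Qed.

(** As long as [e] is not 0, separation puts the smallest variable of [e + a] in [e], so the
    recursion of [gpoly] strips [e] and stops exactly at [a]. *)
Lemma gpoly_canon e a : canon e a -> gpoly J (e + a)%MM = 'X_[e] * Fpoly J a.
Proof.
have [m] := ubnP (mdeg e); elim: m e => // m IH e em [aB sep].
have [->|e0] := eqVneq e 0%MM.
  rewrite add0m mpolyX0 mul1r /gpoly; case: (mdeg a) => [|d] /=; by rewrite aB.
have [j ej] : exists j, (0 < e j)%N.
  apply: contrapT => /forallNP E; move/eqP: e0; apply; apply/mnmP => i.
  by rewrite mnm0E; have := E i; lia.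
have b0 : (e + a)%MM <> 0%MM.
  by move=> /mnmP/(_ j); rewrite mnmDE mnm0E; lia.
have bB : (e + a)%MM \notin min_gens J.
  apply/negP => bB; have := min_gens_min bB (min_gens_in aB) (lem_addl _ _).
  by move=> /mnmP/(_ j); rewrite mnmDE; lia.
have [bi bmin] := min_varP b0; rewrite gpolyE //.
set i := min_var _ in bi bmin *.
have ei : (0 < e i)%N.
  move: bi; rewrite mnmDE addn_gt0 => /orP[//|ai].
  have /eqP/val_inj -> // : (i : nat) == j.
  by rewrite eqn_leq bmin ?sep// mnmDE; lia.
have Ue : (U_(i) <= e)%MM by rewrite lep1mP -lt0n.
have -> : (e + a - U_(i) = (e - U_(i)) + a)%MM.
  by rewrite -{1}(submK Ue) -!addmA [(U_(_) + _)%MM]addmC addmA addmK.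
rewrite IH; last 1 first.
- by apply: (@canon_sub U_(i)%MM); rewrite addmC submK.
- by rewrite mulrA -mpolyXD addmC submK.
- by move: em; rewrite -{1}(submK Ue) mdegD mdeg1; lia.
Qed.

Lemma paramP (k : 'I_(nparams J)) : [/\ (param k).1 \in min_gens J,
  normal_term J (param k).2 & mdeg (param k).2 = mdeg (param k).1].
Proof.
have : param k \in params J by apply: mem_tnth.
move=> /allpairsPdep[a [c [aB + ->]]] /= => /mapP[d].
by rewrite mem_filter => /andP[/andP[/eqP dc /asboolP dJ] _] ->.
Qed.

Lemma Fpoly_coef a : a \in min_gens J -> (Fpoly J a)@_a = 1.
Proof.
move=> aB; rewrite mcoeffB mcoeffX eqxx raddf_sum /= big1 ?subr0 // => k /eqP ka.
rewrite mcoeffZ mcoeffX; case: eqP => [E|_]; last by rewrite mulr0.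
by have [_ + _] := paramP k; rewrite E => /(_ (min_gens_in aB)).
Qed.

Lemma Fpoly_supp a c : c \in msupp (Fpoly J a) ->
  c = a \/ normal_term J c /\ mdeg c = mdeg a.
Proof.
move=> /msuppB_le; rewrite mem_cat msuppX inE.
move=> /orP[/eqP|/msupp_sum_le]; first by left.
move=> /flattenP[_ /mapP[k +] ->] /msuppZ_le; rewrite mem_filter msuppX inE.
by move=> /andP[/eqP <- _] /eqP ->; right; have [] := paramP k.
Qed.


(** Among the factorizations of a term through a minimal generator, the canonical one thus has
    strictly the least weight: [factor_dvd] gives that [a'] divides [a], and minimality makes them
    equal. *)
Lemma canon_wt M e a e' a' : (mdeg (e + a) < M)%N -> a \in min_gens J ->
  canon e' a' -> (e + a = e' + a')%MM -> (wt M e <= wt M e')%N -> e = e' /\ a = a'.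
Proof.
move=> deg_ea aB [a'B sep] E le_wt.
have e'M : (mdeg e' < M)%N.
  by apply: leq_ltn_trans deg_ea; rewrite E mdegD leq_addr.
have a'a := factor_dvd e'M sep E le_wt.
have aa' : a = a' by rewrite (min_gens_min aB (min_gens_in a'B) a'a).
by split => //; move: E; rewrite aa'; apply: addIm.
Qed.

Lemma canon_uniq e a e' a' :
  canon e a -> canon e' a' -> (e + a = e' + a')%MM -> e = e' /\ a = a'.
Proof.
move=> ea e'a' E; pose M := (mdeg (e + a)).+1.
have [le|/ltnW le] := leqP (wt M e) (wt M e').
  by apply: canon_wt e'a' E le => //; case: ea.
have [|-> ->//] := canon_wt _ e'a'.1 ea (esym E) le; by rewrite -E.
Qed.

(** * Reduction *)

Definition low_terms M m w : set mon := [set b | mdeg b = m /\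
  exists e a, [/\ canon e a, b = (e + a)%MM & (wt M e < w)%N]].

Lemma low_termsW M m w w' : (w <= w')%N -> low_terms M m w `<=` low_terms M m w'.
Proof.
move=> ww' b [bm [e [a [ea E lt_w]]]]; split => //.
by exists e, a; split => //; apply: leq_trans ww'.
Qed.

Lemma low_terms_in M m w b : low_terms M m w b -> J 'X_[b].
Proof. by move=> [_ [e [a [/canon_in + -> _]]]]. Qed.

(** If the canonical cofactor of [e + d] had weight at least that of [e], then [factor_dvd] would
    make its generator divide the normal term [d]. The factor [e] is arbitrary because [spoly_low]
    also applies this to non-canonical products. *)
Lemma tail_low M e a d : (mdeg (e + a) < M)%N -> a \in min_gens J ->
  d \in msupp (Fpoly J a) -> d <> a -> J 'X_[e + d] ->
  low_terms M (mdeg (e + a)) (wt M e) (e + d)%MM.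
Proof.
move=> deg_ea aB dF da edJ; have [//|[dN deg_d]] := Fpoly_supp dF.
have deg_ed : mdeg (e + d) = mdeg (e + a) by rewrite !mdegD deg_d.
split => //; have [e' [a' [e'a' E]]] := canon_exists edJ.
exists e', a'; split => //; rewrite ltnNge; apply/negP => le_wt.
have [a'B sep] := e'a'; apply: dN; apply: J_up (min_gens_in a'B) _.
apply: (factor_dvd _ sep E le_wt); apply: leq_ltn_trans deg_ea.
by rewrite -deg_ed E mdegD leq_addr.
Qed.

Lemma low_tail M m w : (m < M)%N -> forall e a d, canon e a ->
  low_terms M m w (e + a)%MM -> d \in msupp (Fpoly J a) -> d <> a ->
  J 'X_[e + d] -> low_terms M m w (e + d)%MM.
Proof.
move=> mM e a d ea [deg_ea [e' [a' [e'a' E lt_w]]]] dF da edJ.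
have [? ?] := canon_uniq ea e'a' E; subst e' a'.
apply: (low_termsW (ltnW lt_w)); rewrite -deg_ea; apply: tail_low => //.
  by rewrite deg_ea.
by case: ea.
Qed.

Lemma step_supp (h : KCx) e a c : canon e a ->
  c \in msupp (h - h@_(e + a) *: ('X_[e] * Fpoly J a)) ->
  c \in msupp h /\ c <> (e + a)%MM \/
  exists d, [/\ d \in msupp (Fpoly J a), d <> a & c = (e + d)%MM].
Proof.
move=> [aB _] cS; have [E|/eqP nE] := eqVneq c (e + a)%MM.
  move: cS; rewrite E mcoeff_msupp mcoeffB mcoeffZ mcoeffXM Fpoly_coef // mulr1.
  by rewrite subrr eqxx.
move: cS => /msuppB_le; rewrite mem_cat => /orP[ch|/msuppZ_le/msuppXM[d dF E]].
  by left.
by right; exists d; split => // da; apply: nE; rewrite E da.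
Qed.

(** [Q] is an invariant of the reduction that records which g's occur: [low_terms] keeps track of
    weights, and the set of all terms of [J] gives [normal_reduction]. *)
Lemma V_reduction_span (Q : set mon) m (h r : KCx) :
  (forall e a d, canon e a -> Q (e + a)%MM -> d \in msupp (Fpoly J a) -> d <> a ->
     J 'X_[e + d] -> Q (e + d)%MM) ->
  V_reduction m h r -> (forall b, b \in msupp h -> J 'X_[b] -> Q b) ->
  span_mod [set 0] (gpoly J @` Q) (h - r) /\
  (forall c, c \in msupp r -> normal_term J c).
Proof.
move=> Qtail; elim=> {h r}[h hN|h b r bJ _ hb _ IH] hQ.
  by split => //; rewrite subrr; apply: span_mod_coef => c; rewrite mcoeff0.
have Qb : Q b by apply: hQ => //; rewrite mcoeff_msupp.
have [e [a [ea E]]] := canon_exists bJ.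
have [|rV rN] := IH.
  move=> c; rewrite {1 2}E gpoly_canon // => /step_supp[//|[ch _]|[d [dF da ->]]].
    exact: hQ.
  by apply: Qtail ea _ dF da; rewrite -E.
split => //; have -> : h - r = h@_b *: gpoly J b + (h - h@_b *: gpoly J b - r).
  by rewrite addrA [_ + (h - _)]addrCA subrr addr0.
by apply: span_mod_comb => //; exists b.
Qed.

(** Outer induction on the weight bound, inner induction on the number of terms of the top weight
    [w]: a step at such a term removes it and adds only normal terms and terms of smaller weight. *)
Lemma V_reduction_exists M m w (h : KCx) : (m < M)%N ->
  (forall b, b \in msupp h -> J 'X_[b] -> low_terms M m w b) ->
  exists r, V_reduction m h r.
Proof.
move=> mM; elim: w h => [|w IHw] h hlow.
  exists h; apply: V_reduced => c /hlow cl cJ.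
  by have [_ [e [a [_ _]]]] := cl cJ.
pose top b := `[< J 'X_[b] /\ ~ low_terms M m w b >].
have [k] := ubnP (size (filter top (msupp h))); elim: k h hlow => // k IHk h hlow sz.
have [/hasP[b bh /asboolP[bJ bw]]|/hasPn notop] :=
  boolP (has top (msupp h)); last first.
  apply: IHw => b bh bJ; apply: contrapT => bw.
  by have /asboolP := notop b bh; apply.
have blow := hlow b bh bJ; have [bm [e [a [ea E _]]]] := blow.
have tails d : d \in msupp (Fpoly J a) -> d <> a -> J 'X_[e + d] ->
    low_terms M m w (e + d)%MM.
  move=> dF da edJ; have [_ [e' [a' [e'a' E' lt_w]]]] := blow.
  rewrite E in E'; have [? ?] := canon_uniq ea e'a' E'; subst e' a'.
  have [aB _] := ea; apply: low_termsW (_ : _ <= w)%N _ _.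
    by rewrite -ltnS; exact: lt_w.
  by rewrite -bm E; apply: tail_low => //; rewrite -E bm.
pose h' := h - h@_b *: gpoly J b.
have h'low c : c \in msupp h' -> J 'X_[c] -> low_terms M m w.+1 c.
  rewrite /h' E gpoly_canon // => /step_supp[//|[ch _]|[d [dF da ->]]] cJ.
    exact: hlow.
  by apply: low_termsW (leqnSn w) _ _; apply: tails.
have sz' : (size (filter top (msupp h')) < k)%N.
  rewrite -ltnS; apply: leq_trans sz; rewrite ltnS.
  have bf : b \in filter top (msupp h).
    by rewrite mem_filter bh andbT; apply/asboolP.
  have szf : (0 < size (filter top (msupp h)))%N by case: filter bf.
  rewrite -(ltn_predK szf) ltnS -(size_rem bf).
  apply: uniq_leq_size; first by rewrite filter_uniq// msupp_uniq.
  move=> c; rewrite mem_filter => /andP[/asboolP[cJ cw]].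
  rewrite /h' {2}E gpoly_canon // {1}E => /step_supp; rewrite -?E.
  move=> -[//|[ch cb]|[d [dF da cE]]].
    rewrite mem_rem_uniq ?filter_uniq ?msupp_uniq// inE mem_filter ch andbT.
    by apply/andP; split; [apply/eqP | apply/asboolP].
  by case: cw; rewrite cE; apply: tails => //; rewrite -cE.
have [r hr] := IHk h' h'low sz'.
by exists r; apply: V_step hr; rewrite // -mcoeff_msupp.
Qed.


(** * The S-polynomials of R' generate all syzygies *)

(** The heads cancel at the lcm, so only tails of the two products remain, and [tail_low] bounds
    them by the weights of the respective cofactors. *)
Lemma spoly_low M a a' : a \in min_gens J -> a' \in min_gens J ->
  (mdeg (mlcm a' a) < M)%N -> canon (mlcm a' a - a')%MM a' ->
  (wt M (mlcm a' a - a') < wt M (mlcm a' a - a))%N ->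
  forall c, c \in msupp (spoly J a' a) -> J 'X_[c] ->
    low_terms M (mdeg (mlcm a' a)) (wt M (mlcm a' a - a)) c.
Proof.
move=> aB a'B degM ca' lt_wt c cS cJ.
have E' := submK (lem_mlcml a' a); have E := submK (lem_mlcmr a' a).
set L := mlcm a' a in E E' *.
have S_L : (spoly J a' a)@_L = 0.
  have := mcoeffXM (L - a') a' (Fpoly J a'); have := mcoeffXM (L - a) a (Fpoly J a).
  by rewrite E' E !Fpoly_coef // mcoeffB => -> ->; rewrite subrr.
have cL : c <> L by move=> cL; move: cS; rewrite cL mcoeff_msupp S_L eqxx.
move: cS; rewrite /spoly => /msuppB_le; rewrite mem_cat => /orP[] /msuppXM[d dF cE].
  have da' : d <> a' by move=> da'; apply: cL; rewrite cE da'.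
  rewrite cE in cJ *; apply: (low_termsW (ltnW lt_wt)).
  by have := @tail_low M _ _ _ _ a'B dF da' cJ; rewrite E'; apply.
have da : d <> a by move=> da; apply: cL; rewrite cE da.
rewrite cE in cJ *.
by have := @tail_low M _ _ _ _ aB dF da cJ; rewrite E; apply.
Qed.

(** Strong induction on the weight of [e]. The bound is [(wt M e).+1] because [e] itself may be the
    canonical cofactor. *)
Lemma mul_Fpoly_span (I : set KC) M e a : is_ideal I ->
  (forall a a', a \in min_gens J -> a' \in min_gens J ->
     canon (mlcm a a' - a)%MM a -> spoly_reduction_coeff a a' `<=` I) ->
  a \in min_gens J -> (mdeg (e + a) < M)%N ->
  span_mod I (gpoly J @` low_terms M (mdeg (e + a)) (wt M e).+1) ('X_[e] * Fpoly J a).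
Proof.
move=> II SI; have [I0 ID IM] := II.
have [w] := ubnP (wt M e); elim: w e a => // w IH e a ew aB eaM.
have [ea|nea] := pselect (canon e a).
  rewrite -gpoly_canon //; apply: span_mod_gen => //; exists (e + a)%MM => //.
  by split => //; exists e, a.
have eaJ : J 'X_[e + a] by apply: J_up (min_gens_in aB) (lem_addl _ _).
have [e' [a' [e'a' E]]] := canon_exists eaJ; have [a'B _] := e'a'.
have lt_wt : (wt M e' < wt M e)%N.
  rewrite ltnNge; apply/negP => le.
  by have [? ?] := canon_wt eaM aB e'a' E le; subst e' a'.
have Lea : (mlcm a' a <= e + a)%MM.
  by rewrite lem_mlcm {1}E !lem_addl.
(* Both products are multiples by [t] of the two halves of the S-polynomial; since [wt] is additive,
   comparisons of cofactors pass between [L] and [e + a]. *)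
pose L := mlcm a' a; pose t := (e + a - L)%MM.
have tL : (t + L = e + a)%MM by rewrite submK.
have eE : e = (t + (L - a))%MM.
  by apply: (@addIm _ a); rewrite -tL -addmA submK // lem_mlcmr.
have e'E : e' = (t + (L - a'))%MM.
  by apply: (@addIm _ a'); rewrite -E -tL -addmA submK // lem_mlcml.
have cL : canon (L - a')%MM a' by apply: (@canon_sub t); rewrite -e'E.
have LM : (mdeg L < M)%N.
  by apply: leq_ltn_trans eaM; rewrite -tL mdegD leq_addl.
have lt_wtL : (wt M (L - a') < wt M (L - a))%N.
  by move: lt_wt; rewrite eE e'E !wtD ltn_add2l.
have slow := spoly_low aB a'B LM cL lt_wtL.
have [r Sr] := V_reduction_exists LM slow.
have [rV rN] := V_reduction_span (low_tail (w := wt M (L - a)) LM) Sr slow.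
have -> : 'X_[e] * Fpoly J a = 'X_[e'] * Fpoly J a' -
    ('X_[t] * (spoly J a' a - r) + 'X_[t] * r).
  rewrite -mulrDr subrK /spoly [X in _ - X]mulrBr !mulrA -!mpolyXD -eE -e'E.
  by rewrite opprB addrCA subrr addr0.
apply: span_modB => //; [|apply: span_modD => //].
- rewrite -gpoly_canon //; apply: span_mod_gen => //; exists (e' + a')%MM => //.
  rewrite -E.
  by split => //; exists e', a'; split => //; apply: ltnW.
- apply: (span_mod_mul II _ _ rV) => [u -> //|_ [b [bL [e2 [a2 [ea2 bE lt2]]]] <-]].
  rewrite bE gpoly_canon // mulrA -mpolyXD; have [a2B _] := ea2.
  have deg2 : mdeg (t + e2 + a2) = mdeg (e + a).
    by rewrite -addmA -bE mdegD bL -mdegD tL.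
  have lt_wt2 : (wt M (t + e2) < wt M e)%N by rewrite eE !wtD ltn_add2l.
  apply: span_mod_sub (IH (t + e2)%MM a2 _ a2B _) => //; rewrite ?deg2 //.
    by move=> _ [b' b'low <-]; apply: span_mod_gen => //; exists b' => //;
      apply: low_termsW b'low; apply: ltnW.
  exact: leq_trans lt_wt2 _.
- have rI c : I r@_c by apply: SI cL _ _ => //; exists r, c.
  (* With no generators, the span consists of the polynomials with all coefficients in [I]. *)
  by apply: (@span_mod_mul _ _ I I set0) => //; apply: span_mod_coef.
Qed.

(** * Uniqueness of normal forms *)

Definition normal_poly (p : KCx) := forall c, c \in msupp p -> normal_term J c.

Lemma normal_poly_comb u g p :
  normal_poly g -> normal_poly p -> normal_poly (u *: g + p).
Proof.
move=> gN pN c /msuppD_le; rewrite mem_cat => /orP[/msuppZ_le|]; [exact: gN|exact: pN].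
Qed.

(* Unlike a step of a V-reduction, this rewrites all the terms of J at once, which
   makes it linear. *)
Definition reduce (p : KCx) : KCx :=
  p - \sum_(b <- msupp p | `[< J 'X_[b] >]) p@_b *: gpoly J b.

(** Terms outside the support contribute 0; a common list for several polynomials then gives the
    linearity of [reduce]. *)
Lemma reduceE (s : seq mon) p : uniq s -> {subset msupp p <= s} ->
  reduce p = p - \sum_(b <- s | `[< J 'X_[b] >]) p@_b *: gpoly J b.
Proof.
move=> us ps; congr (_ - _).
rewrite (perm_big [seq b <- s | b \in msupp p]) /=; last first.
  apply: uniq_perm; rewrite ?msupp_uniq ?filter_uniq // => b.
  by rewrite mem_filter; case: (boolP (b \in msupp p)) => // /ps.
rewrite big_filter_cond big_mkcond [RHS]big_mkcond; apply: eq_bigr => b _.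
by case: (boolP (b \in msupp p)) => //= /memN_msupp_eq0 ->; rewrite scale0r if_same.
Qed.

Lemma reduce_comb u g p : reduce (u *: g + p) = u *: reduce g + reduce p.
Proof.
pose s := undup (msupp g ++ msupp p); have us : uniq s by apply: undup_uniq.
rewrite !(reduceE us); try by move=> b; rewrite mem_undup mem_cat => ->; rewrite ?orbT.
  rewrite scalerBr addrACA -opprD scaler_sumr -big_split /=; congr (_ - _).
  by apply: eq_bigr => b _; rewrite mcoeffD mcoeffZ scalerDl scalerA.
move=> b /msuppD_le; rewrite mem_undup !mem_cat.
by move=> /orP[/msuppZ_le ->//|->]; rewrite orbT.
Qed.

Lemma iter_reduce_comb k u g p :
  iter k reduce (u *: g + p) = u *: iter k reduce g + iter k reduce p.
Proof. by elim: k => //= k ->; rewrite reduce_comb. Qed.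

Lemma iter_reduce_normal k p : normal_poly p -> iter k reduce p = p.
Proof.
move=> pN; elim: k => //= k ->; rewrite /reduce big_seq_cond big1 ?subr0 //.
by move=> b /andP[/pN bN /asboolP].
Qed.

Lemma reduceX b : J 'X_[b] -> reduce 'X_[b] = 'X_[b] - gpoly J b.
Proof.
move=> bJ; rewrite /reduce msuppX big_cons big_nil asboolT //.
by rewrite mcoeffX eqxx scale1r addr0.
Qed.

Lemma iter_reduce_supp k p :
  (forall c, c \in msupp p -> normal_poly (iter k reduce 'X_[c])) ->
  normal_poly (iter k reduce p).
Proof.
rewrite {2}[p]mpolyE; elim: (msupp p) => [_|b s IHs bsN].
  by rewrite big_nil iter_reduce_normal => c; rewrite msupp0.
rewrite big_cons iter_reduce_comb; apply: normal_poly_comb.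
  by apply: bsN; rewrite inE eqxx.
by apply: IHs => c cs; apply: bsN; rewrite inE cs orbT.
Qed.

(** Each round replaces a term of [J] by normal terms and terms of smaller weight, so the weight
    bound also bounds the number of rounds; for [w = 0] the set [low_terms] is empty. *)
Lemma iter_reduceX M m w b : (m < M)%N -> low_terms M m w b ->
  normal_poly (iter w reduce 'X_[b]).
Proof.
move=> mM; elim: w b => [|w IH] b blow; first by have [_ [e [a []]]] := blow.
have [bm [e [a [ea E lt_w]]]] := blow; have [aB _] := ea.
rewrite iterSr reduceX; last exact: low_terms_in blow.
apply: iter_reduce_supp => c.
have -> : 'X_[b] - gpoly J b = 'X_[b] - 'X_[b]@_(e + a) *: ('X_[e] * Fpoly J a).
  by rewrite mcoeffX -E eqxx scale1r E gpoly_canon.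
move=> /step_supp[//|[]|[d [dF da ->]]]; first by rewrite msuppX inE => /eqP -> /(_ E).
have [edJ|edN] := pselect (J 'X_[e + d]).
  apply/IH/(@low_termsW _ _ (wt M e)); first by rewrite -ltnS.
  by rewrite -bm E; apply: tail_low => //; rewrite -E bm.
by rewrite iter_reduce_normal => c'; rewrite msuppX inE => /eqP ->.
Qed.

Lemma iter_reduce_le k k' p : (k <= k')%N ->
  normal_poly (iter k reduce p) -> iter k' reduce p = iter k reduce p.
Proof. by move=> kk' pN; rewrite -(subnK kk') iterD iter_reduce_normal. Qed.

Lemma iter_reduce_exists p : exists k, normal_poly (iter k reduce p).
Proof.
suff [k kP] : exists k, forall c, c \in msupp p -> normal_poly (iter k reduce 'X_[c]).
  by exists k; apply: iter_reduce_supp.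
elim: (msupp p) => [|b s [k kP]]; first by exists 0%N.
have [k0 k0P] : exists k, normal_poly (iter k reduce 'X_[b]).
  have [bJ|bN] := pselect (J 'X_[b]); last first.
    by exists 0%N => c /=; rewrite msuppX inE => /eqP ->.
  have [e [a [ea E]]] := canon_exists bJ.
  exists (wt (mdeg b).+1 e).+1; apply: (iter_reduceX (ltnSn _)).
  by split => //; exists e, a.
exists (maxn k0 k) => c; rewrite inE => /orP[/eqP ->|cs].
  by rewrite (iter_reduce_le (leq_maxl _ _) k0P).
by rewrite (iter_reduce_le (leq_maxr _ _) (kP c cs)); apply: kP.
Qed.

Local Notation Jpolys := (gpoly J @` [set b | J 'X_[b]]).

Lemma reduce_span k p : span_mod [set 0] Jpolys (p - iter k reduce p).
Proof.
have I0 := is_ideal0 KC.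
elim: k => [|k IH] /=.
  by rewrite subrr; apply: span_mod_coef => c; rewrite mcoeff0.
rewrite {1}/reduce opprB addrCA.
apply: span_modD => //; rewrite big_mkcond /=; elim: (msupp _) => [|b s IHs].
  by rewrite big_nil; apply: span_mod_coef => c; rewrite mcoeff0.
rewrite big_cons; case: asboolP => bJ; last by rewrite add0r.
by apply: span_mod_comb => //; exists b.
Qed.

Lemma iter_reduce_coef (I : set KC) k p : is_ideal I ->
  (forall c, I p@_c) -> forall c, I (iter k reduce p)@_c.
Proof.
move=> II pI; elim: k => //= k IH c; rewrite mcoeffB raddf_sum /=.
apply: is_idealB => //; rewrite big_mkcond /=; apply: is_ideal_sum => // b _.
have [I0 _ IM] := II; case: asboolP => // _; rewrite ?mcoeff0 //.
by rewrite mcoeffZ mulrC; apply: IM.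
Qed.

(** Enough rounds of the linear map [reduce] send every g to 0 and keep coefficients in [I], while a
    normal polynomial is fixed. *)
Lemma normal_span (I : set KC) p : is_ideal I -> span_mod I Jpolys p ->
  normal_poly p -> forall c, I p@_c.
Proof.
move=> II pV pN; have [I0 ID IM] := II.
(* Asking for all large [k'] lets the bounds for the successive summands be combined by a
   maximum. *)
suff [k kP] : exists k, forall k', (k <= k')%N -> forall c, I (iter k' reduce p)@_c.
  by move=> c; rewrite -(iter_reduce_normal k pN); apply: kP.
elim: pV {pN} => [q qI|u g q [b bJ <-] _ [k kP]].
  by exists 0%N => k' _; apply: iter_reduce_coef.
pose t := 'X_[b] - gpoly J b; have [k0 k0P] := iter_reduce_exists t.
exists (maxn k0.+1 k) => k'; rewrite geq_max => /andP[+ kk'] c.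
rewrite iter_reduce_comb mcoeffD; case: k' kk' => // k' kk' k0k'.
suff -> : iter k'.+1 reduce (gpoly J b) = 0 by rewrite scaler0 mcoeff0 add0r; apply: kP.
(* As [t] is [reduce 'X_[b]], the [k'.+1] rounds on the term are [k'] rounds on [t]. Both iterates
   of [t] have stabilized, so they cancel; hence [k0.+1] in the bound. *)
have -> : gpoly J b = (-1) *: t + 'X_[b] by rewrite scaleN1r opprB subrK.
rewrite iterSr reduce_comb reduceX // iter_reduce_comb -iterSr.
rewrite -/t (iter_reduce_le (k' := k'.+1) _ k0P) ?(ltnW k0k') //.
rewrite (iter_reduce_le _ k0P) //.
by rewrite scaleN1r addNr.
Qed.

(** * Specialization *)

Lemma param_inj : injective (@param K n J).
Proof.
apply/tuple_uniqP; rewrite /= /params; have [uB _ _] := min_gensP J_monomial.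
apply: allpairs_uniq_dep => // [a _|[a c] [a' c'] _ _ /= [-> ->] //].
rewrite map_inj_uniq; last exact: val_inj.
by rewrite filter_uniq// enum_uniq.
Qed.

Lemma param_surj a c : a \in min_gens J -> normal_term J c -> mdeg c = mdeg a ->
  exists k : 'I_(nparams J), param k = (a, c).
Proof.
move=> aB cN ca.
have acP : (a, c) \in params J.
  apply: allpairs_f_dep => //; apply/mapP.
  have cd : (mdeg c < (mdeg a).+1)%N by rewrite ca.
  exists (BMultinom cd) => //; rewrite mem_filter mem_enum andbT.
  by rewrite ca eqxx; apply/asboolP.
by have /tnthP[k ->] : (a, c) \in in_tuple (params J) by []; exists k.
Qed.

Section Specialization.
Local Notation Kx := {mpoly K[n.+1]}.
Variable (c : {ffun 'I_(nparams J) -> K}).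
Implicit Types (p q : Kx) (v : KCx) (I : set Kx).

Definition spec : KCx -> Kx := map_mpoly (meval c).
Definition lift : Kx -> KCx := map_mpoly (@mpolyC (nparams J) K).
Definition eval_ker : set KC := [set u | u.@[c] = 0].

Lemma spec_coef v b : (spec v)@_b = (v@_b).@[c].
Proof. exact: mcoeff_map_mpoly. Qed.

Lemma lift_coef p b : (lift p)@_b = (p@_b)%:MP.
Proof. exact: mcoeff_map_mpoly. Qed.

Lemma specB : {morph spec : v v' / v - v'}. Proof. exact: raddfB. Qed.
Lemma specM : {morph spec : v v' / v * v'}. Proof. exact: rmorphM. Qed.

Lemma spec_comb u g v : spec (u *: g + v) = u.@[c] *: spec g + spec v.
Proof. by apply/mpolyP => b; rewrite !(spec_coef, mcoeffD, mcoeffZ) mevalD mevalM. Qed.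

Lemma liftK p : spec (lift p) = p.
Proof. by apply/mpolyP => b; rewrite spec_coef lift_coef mevalC. Qed.

Lemma spec_eq0 v : spec v = 0 <-> forall b, eval_ker v@_b.
Proof.
split=> [v0 b|vK]; first by rewrite /eval_ker /= -spec_coef v0 mcoeff0.
by apply/mpolyP => b; rewrite spec_coef mcoeff0; apply: vK.
Qed.

Lemma is_ideal_ker : is_ideal eval_ker.
Proof.
split=> [|u u' /= u0 u'0|u u' /= u'0]; rewrite /eval_ker /=.
- exact: meval0.
- by rewrite mevalD u0 u'0 addr0.
- by rewrite mevalM u'0 mulr0.
Qed.

Lemma specX e : spec 'X_[e] = 'X_[e]. Proof. exact: map_mpolyX. Qed.

Lemma spec_Fpoly a : spec (Fpoly J a) =
  'X_[a] - \sum_(k < nparams J | (param k).1 == a) c k *: 'X_[(param k).2].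
Proof.
rewrite specB specX; congr (_ - _); rewrite /spec raddf_sum; apply: eq_bigr => k _.
by rewrite /= map_mpolyZ /= map_mpolyX mevalXU.
Qed.

Lemma spec_span (I : set Kx) (N : set KC) G v : is_ideal I -> N `<=` eval_ker ->
  (forall g, G g -> I (spec g)) -> span_mod N G v -> I (spec v).
Proof.
move=> II NK GI; have [I0 ID IM] := II; elim=> [q qN|u g q Gg _ Iq].
  by have -> : spec q = 0 by apply/spec_eq0 => b; apply/NK/qN.
by rewrite spec_comb; apply: ID => //; rewrite -mul_mpolyC; apply/IM/GI.
Qed.

Lemma spec_gpoly I b : is_ideal I ->
  (forall a, a \in min_gens J -> I (spec (Fpoly J a))) ->
  J 'X_[b] -> I (spec (gpoly J b)).
Proof.
move=> [_ _ IM] IF bJ; have [e [a [ea ->]]] := canon_exists bJ.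
by rewrite gpoly_canon // specM; apply/IM/IF; case: ea.
Qed.

Lemma spec_Fpoly_in a : a \in min_gens J -> specialized_ideal J c (spec (Fpoly J a)).
Proof. by move=> aB; apply: ideal_gen_sub; exists a. Qed.

Lemma spec_normal v b : normal_poly v -> b \in msupp (spec v) -> normal_term J b.
Proof.
move=> vN bv; apply: vN; move: bv; rewrite !mcoeff_msupp spec_coef.
by apply: contra_neq => ->; rewrite meval0.
Qed.

Lemma spoly_spec I a a' : is_ideal I ->
  (forall a, a \in min_gens J -> I (spec (Fpoly J a))) ->
  a \in min_gens J -> a' \in min_gens J -> I (spec (spoly J a a')).
Proof.
move=> II IF aB a'B; have [_ _ IM] := II; rewrite specB !specM.
by apply: is_idealB => //; apply/IM/IF.
Qed.

Lemma normal_reduction m (h r : KCx) : V_reduction m h r ->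
  span_mod [set 0] Jpolys (h - r) /\ normal_poly r.
Proof. by move=> hr; apply: V_reduction_span hr _. Qed.

(** The specialized reduction of an S-polynomial lies in [I] and has normal support, so it vanishes:
    the generators of R are 0 at [c]. *)
Lemma zero_locus_of_basis I : is_ideal I ->
  (forall p, (forall b, b \in msupp p -> normal_term J b) -> I p -> p = 0) ->
  (forall a, a \in min_gens J -> I (spec (Fpoly J a))) -> zero_locus (frakR J) c.
Proof.
move=> II IN IF; apply: (ideal_gen_min is_ideal_ker).
move=> _ [a [a' [aB a'B [r [b [/normal_reduction[rV rN] ->]]]]]].
rewrite /eval_ker /= -spec_coef.
have Ir : I (spec r).
  rewrite -[spec r](subKr (spec (spoly J a a'))) -specB; apply: is_idealB => //.
    exact: spoly_spec.
  apply: spec_span rV => // [_ -> |_ [d dJ <-]]; first exact: meval0.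
  exact: spec_gpoly.
by rewrite (IN (spec r)) ?mcoeff0 // => d; apply: spec_normal.
Qed.

Hypothesis c_zero : zero_locus (frakR J) c.

Lemma mul_Jpolys q v :
  span_mod (frakR J) Jpolys v -> span_mod (frakR J) Jpolys (lift q * v).
Proof.
have RI : is_ideal (frakR J) by apply: ideal_gen_is_ideal.
rewrite [lift q]mpolyE mulr_suml; elim: (msupp _) => [|e s IHs] vV.
  by rewrite big_nil; apply: span_mod_coef => b; rewrite mcoeff0; case: RI.
rewrite big_cons -scalerAl; apply: span_modD; [|apply: span_modZ|apply: IHs] => //.
apply: span_mod_mul vV => // _ [b bJ <-].
have [e' [a [ea ->]]] := canon_exists bJ; have [aB _] := ea.
rewrite gpoly_canon // mulrA -mpolyXD.
apply: span_mod_sub (mul_Fpoly_span (M := (mdeg (e + e' + a)).+1) RI _ aB _) => //.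
  by move=> _ [d /low_terms_in dJ <-]; apply: span_mod_gen; [case: RI | exists d].
by move=> a1 a2 a1B a2B _ u uS; apply: ideal_gen_sub; exists a1, a2.
Qed.

(** The specialized span is an ideal by [mul_Jpolys]. This lets members of the specialized ideal be
    lifted to K[C], where [normal_span] is available. *)
Lemma specialized_idealP p :
  specialized_ideal J c p <-> exists2 v, span_mod (frakR J) Jpolys v & p = spec v.
Proof.
have RI : is_ideal (frakR J) by apply: ideal_gen_is_ideal.
have Ic : is_ideal (specialized_ideal J c) by apply: ideal_gen_is_ideal.
split; last first.
  move=> [v vV ->]; apply: spec_span vV => // _ [b bJ <-].
  by apply: spec_gpoly => //; apply: spec_Fpoly_in.
pose V : set Kx := [set p | exists2 v, span_mod (frakR J) Jpolys v & p = spec v].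
suff : specialized_ideal J c `<=` V by apply.
apply: ideal_gen_min => [|_ [a aB <-]]; last first.
  exists (gpoly J a); last first.
    by rewrite /gpoly; case: (mdeg a) => /= [|d]; rewrite [_ \in _]aB.
  by apply: span_mod_gen; [case: RI | exists a => //; apply: min_gens_in].
split=> [|_ _ [v vV ->] [v' v'V ->]|q _ [v vV ->]].
- exists 0; last by rewrite /spec raddf0.
  by apply: span_mod_coef => b; rewrite mcoeff0; case: RI.
- by exists (v + v'); [apply: span_modD | rewrite /spec raddfD].
- by exists (lift q * v); [apply: mul_Jpolys | rewrite specM liftK].
Qed.

Lemma specialized_basis : quotient_basis (specialized_ideal J c) (normal_term J).
Proof.
have KI := is_ideal_ker; have [K0 _ _] := KI.
have Ic : is_ideal (specialized_ideal J c) by apply: ideal_gen_is_ideal.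
split=> [p pN /specialized_idealP[v vV pE]|p].
  (* The lift of [p] differs from [v] by coefficients vanishing at [c], so it lies in the span of
     the g's modulo [eval_ker], which contains R. *)
  rewrite -[p]liftK; apply/spec_eq0; apply: (normal_span KI).
    rewrite -(subrK v (lift p)); apply: span_modD => //.
      by apply: span_mod_coef; apply/spec_eq0; rewrite specB liftK pE subrr.
    apply: span_mod_sub vV => // g Jg; exact: span_mod_gen.
  move=> b bp; apply: pN; move: bp; rewrite !mcoeff_msupp lift_coef.
  by apply: contra_neq => ->.
have [k kN] := iter_reduce_exists (lift p).
exists (spec (iter k reduce (lift p))); first by move=> b; apply: spec_normal.
rewrite -[X in X - _]liftK -specB.
apply: spec_span (reduce_span k (lift p)) => // [_ -> //|_ [b bJ <-]].
by apply: spec_gpoly => //; apply: spec_Fpoly_in.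
Qed.

(** The part with coefficients in R specializes to 0, and each specialized g is homogeneous, so
    taking a component keeps or drops it whole. *)
Lemma specialized_homogeneous : homogeneous_ideal (specialized_ideal J c).
Proof.
have Ic : is_ideal (specialized_ideal J c) by apply: ideal_gen_is_ideal.
have [I0 ID IM] := Ic.
split=> // p d /specialized_idealP[v vV ->].
elim: vV => [q qR|u g q [b bJ <-] _ Iq].
  have -> : spec q = 0 by apply/spec_eq0 => b; apply: c_zero.
  by rewrite pihomog0.
rewrite spec_comb raddfD /= linearZ /=; apply: ID => //; rewrite -mul_mpolyC; apply: IM.
have gI : specialized_ideal J c (spec (gpoly J b)).
  by apply: spec_gpoly => //; apply: spec_Fpoly_in.
have hom : spec (gpoly J b) \is (mdeg b).-homog for mdeg.
  apply/dhomogP => m; rewrite !mcoeff_msupp spec_coef => mg.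
  have [e [a [ea bE]]] := canon_exists bJ.
  have /msuppXM[f /Fpoly_supp fF ->] : m \in msupp ('X_[e] * Fpoly J a).
    rewrite -gpoly_canon // -bE mcoeff_msupp.
    by apply: contra_neq mg => ->; rewrite meval0.
  by rewrite bE [LHS]mdegD mdegD; case: fF => [->|[_ ->]].
have [<-|ne] := eqVneq (mdeg b) d; first by rewrite pihomog_dE.
by rewrite (pihomog_ne0 ne).
Qed.

End Specialization.

(** * The bijection, and equality of the two ideals *)

Lemma specialized_ideal_inj : set_inj (zero_locus (frakR J)) (specialized_ideal J).
Proof.
move=> c c' /set_mem cZ _ eqI; apply/ffunP => k.
have [aB cN _] := paramP k; set a := (param k).1 in aB.
have [Ic _] := specialized_homogeneous cZ.
have [IN _] := specialized_basis cZ.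
pose F (c0 : {ffun 'I_(nparams J) -> K}) :=
  \sum_(k < nparams J | (param k).1 == a) c0 k *: 'X_[K, (param k).2].
have FE (c0 : {ffun _ -> K}) : (F c0)@_(param k).2 = c0 k.
  rewrite raddf_sum (bigD1 k) //= mcoeffZ mcoeffX eqxx mulr1 big1 ?addr0 //.
  move=> k' /andP[/eqP k'a /negP k'k]; rewrite mcoeffZ mcoeffX.
  case: eqP => [E|_]; last by rewrite mulr0.
  case: k'k; apply/eqP/param_inj.
  by rewrite [LHS]surjective_pairing k'a E -surjective_pairing.
have FN (c0 : {ffun _ -> K}) b : b \in msupp (F c0) -> normal_term J b.
  move=> /msupp_sum_le/flattenP[_ /mapP[k' _ ->]] /msuppZ_le.
  by rewrite msuppX inE => /eqP ->; have [] := paramP k'.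
(* The two specializations of the same generator differ by a polynomial of the common ideal with
   normal support. *)
have : F c' - F c = 0.
  apply: IN; first by move=> b /msuppB_le; rewrite mem_cat => /orP[] /FN.
  have -> : F c' - F c = spec c (Fpoly J a) - spec c' (Fpoly J a).
    by rewrite !spec_Fpoly -/(F c) -/(F c') opprD addrACA subrr add0r opprK addrC.
  by apply: (is_idealB Ic); [|rewrite eqI]; apply: spec_Fpoly_in.
move=> /(congr1 (mcoeff (param k).2)) /eqP.
by rewrite mcoeffB mcoeff0 !FE subr_eq0 => /eqP.
Qed.

Lemma specialized_ideal_surj I :
  homogeneous_ideal I -> quotient_basis I (normal_term J) ->
  exists2 c, zero_locus (frakR J) c & specialized_ideal J c = I.
Proof.
move=> [II Ihom] [IN Ispan].
have /choice[Q QP] (a : mon) : exists q, [/\ I ('X_[a] - q),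
    forall b, b \in msupp q -> normal_term J b
  & forall b, b \in msupp q -> mdeg b = mdeg a].
  (* The parameters cover only terms of degree [mdeg a]; homogeneity of [I] allows the normal form
     to be cut down to that degree. *)
  have [q qN Iq] := Ispan 'X_[a]; exists (pihomog mdeg (mdeg a) q); split.
  - by have := Ihom _ (mdeg a) Iq; rewrite pihomogB pihomogX eqxx.
  - move=> b /msupp_sum_le/flattenP[_ /mapP[d + ->]] /msuppZ_le.
    by rewrite mem_filter msuppX inE => /andP[_ /qN dN] /eqP ->.
  - exact: (dhomogP _ _ _ (pihomogP mdeg (mdeg a) q)).
pose c := [ffun k : 'I_(nparams J) => (Q (param k).1)@_(param k).2].
have IF a : a \in min_gens J -> I (spec c (Fpoly J a)).
  move=> aB; have [IQ QN Qdeg] := QP a.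
  suff -> : spec c (Fpoly J a) = 'X_[a] - Q a by [].
  rewrite spec_Fpoly; congr (_ - _); apply/mpolyP => b; rewrite raddf_sum /=.
  have [bQ|bQ] := boolP (b \in msupp (Q a)); last first.
    rewrite (memN_msupp_eq0 bQ) big1 // => k /eqP ka.
    rewrite mcoeffZ mcoeffX ffunE ka; case: eqP => [->|_]; last by rewrite mulr0.
    by rewrite (memN_msupp_eq0 bQ) mul0r.
  have [k kE] := param_surj aB (QN _ bQ) (Qdeg _ bQ).
  rewrite (bigD1 k) ?kE //= mcoeffZ mcoeffX eqxx mulr1 ffunE kE /= big1 ?addr0 //.
  move=> k' /andP[/eqP k'a /negP k'k]; rewrite mcoeffZ mcoeffX.
  case: eqP => [E|_]; last by rewrite mulr0.
  by case: k'k; apply/eqP/param_inj; rewrite kE [LHS]surjective_pairing k'a E.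
have cZ := zero_locus_of_basis II IN IF; exists c => //.
have IcI : specialized_ideal J c `<=` I by apply: ideal_gen_min => // _ [a /IF + <-].
apply/seteqP; split => // p Ip.
(* The normal form of [p] modulo the smaller ideal lies in [I] as well, hence is 0. *)
have [_ cspan] := specialized_basis cZ; have [q qN pq] := cspan p.
suff q0 : q = 0 by move: pq; rewrite q0 subr0.
by apply: IN => //; rewrite -[q](subKr p); apply: is_idealB => //; apply: IcI.
Qed.

Lemma frakR'_eq : frakR' J = frakR J.
Proof.
have RI : is_ideal (frakR' J) by apply: ideal_gen_is_ideal.
have RI' : is_ideal (frakR J) by apply: ideal_gen_is_ideal.
apply/seteqP; split; apply: ideal_gen_min => //.
  by move=> u [a [a' [aB a'B _ uS]]]; apply: ideal_gen_sub; exists a, a'.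
(* For a canonical cofactor, [gpoly_canon] identifies the first product with the g of the lcm, which
   is the condition selecting the generators of R'. *)
have crit a a' : a \in min_gens J -> a' \in min_gens J ->
    canon (mlcm a a' - a)%MM a -> spoly_reduction_coeff a a' `<=` frakR' J.
  move=> aB a'B ca u uS; apply: ideal_gen_sub; exists a, a'; split => //.
  exists (mlcm a a'); rewrite -?(gpoly_canon ca) ?submK ?lem_mlcml //.
  by split => //; apply: J_up (min_gens_in aB) (lem_mlcml _ _).
have FV e a : a \in min_gens J -> span_mod (frakR' J) Jpolys ('X_[e] * Fpoly J a).
  move=> aB; pose M := (mdeg (e + a)).+1.
  apply: span_mod_sub (mul_Fpoly_span (M := M) RI crit aB _) => //.
  by move=> _ [d /low_terms_in dJ <-]; apply: span_mod_gen; [case: RI | exists d].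
move=> _ [a [a' [aB a'B [r [b [/normal_reduction[rV rN] ->]]]]]].
(* The reduction [r] of an arbitrary S-polynomial is in the span modulo R', since both the
   S-polynomial and its difference with [r] are. *)
apply: normal_span => //; rewrite -[r](subKr (spoly J a a')).
apply: span_modB => //; first by apply: span_modB => //; apply: FV.
apply: span_mod_sub rV => // [_ ->|g Jg]; first by case: RI.
by apply: span_mod_gen => //; case: RI.
Qed.

End Canon.

Unset Implicit Arguments.

Theorem theorem4p1 (K : fieldType) (n : nat) (J : set {mpoly K[n.+1]})
    (J_monomial : monomial_ideal J) (J_stable : strongly_stable J) :
  set_bij (zero_locus (frakR J))
    [set I : set {mpoly K[n.+1]} |
      homogeneous_ideal I /\ quotient_basis I (normal_term J)]
    (specialized_ideal J) /\
  frakR' J = frakR J.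
Proof.
split; last exact: frakR'_eq.
split=> [c cZ||I [Ihom Ibasis]].
- by split; [apply: specialized_homogeneous | apply: specialized_basis].
- exact: specialized_ideal_inj.
- by have [c cZ <-] := specialized_ideal_surj J_monomial J_stable Ihom Ibasis; exists c.
Qed.
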